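(* For each $1\leq p < \infty$, $B^{p}$ contains an isometric and complemented copy of $\ell^{p}(\mathfrak c,L^{p}[0,1])$.
   Context: Let $\mathcal{B}$ be the Borel $\sigma$-algebra of $\mathbb{R}$, $\lambda$ the Lebesgue measure, and $\mathcal{B}_{\infty}$ the $\sigma$-algebra on $\mathbb{R}^{\mathbb{N}}$ generated by the cylinder sets $\prod_{i=1}^{m}C_{i}\times\prod_{i=m+1}^{\infty}\mathbb{R}$ with $C_i\in\mathcal{B}$, $m\in\mathbb{N}$. Let $\mathcal{F}(\mathcal{B},\lambda)$ be the set of finite rectangles $\prod_{i\in\mathbb{N}}C_{i}$ with $C_i\in\mathcal{B}$ and $\prod_{i}\lambda(C_i)\in[0,\infty)$, with $\mathrm{vol}(\prod_{i}C_i):=\prod_i\lambda(C_i)$. The measure $\mu$ is the restriction to $\mathcal{B}_{\infty}$ of the outer measure $\mu^{\ast}(A):=\inf\{\sum_{n}\mathrm{vol}(\mathscr{C}_{n}) : \mathscr{C}_{n}\in\mathcal{F}(\mathcal{B},\lambda),\ A\subset\bigcup_{n}\mathscr{C}_{n}\}$ ($\inf\varnothing=\infty$). Let $I:=\mathbb{Z}^{\mathbb{N}}$ and, for $\mathfrak{a}=(a_n)\in I$, $\mathcal{C}_{\mathfrak{a}}:=\prod_{n\in\mathbb{N}}[a_{n},a_{n}+1)$. Define $B^{p}:=\{f\in L^{p}(\mu) : \int_{\mathcal{C}_{\mathfrak{a}}}|f|^{p}\,d\mu=0 \text{ for each } \mathfrak{a}\in I\}$, a closed subspace of $L^p(\mu)$.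 $\ell^{p}(\kappa,X)$ denotes the $\ell^p$-sum of $\kappa$ copies of the Banach space $X$, and $\mathfrak{c}$ is the cardinality of the continuum. *)

(* Defs.v *)
From HB Require Import structures.
From mathcomp Require Import all_boot all_order all_algebra.
From mathcomp Require Import all_classical all_reals all_analysis.
Set Implicit Arguments. Unset Strict Implicit. Unset Printing Implicit Defensive.
Import Order.TTheory GRing.Theory Num.Theory.
Import numFieldNormedType.Exports.
Local Open Scope classical_set_scope.
Local Open Scope ring_scope.

Section InfiniteProduct.
Variable R : realType.

Definition cylinder (A : set (nat -> R)) : Prop :=
  exists (m : nat) (C : nat -> set (measurableTypeR R)),
    (forall i, measurable (C i)) /\
    A = [set x | forall i, (i < m)%N -> C i (x i)].

Definition RN := g_sigma_algebraType cylinder.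

Definition rect (C : nat -> set (measurableTypeR R)) : set (nat -> R) :=
  [set x | forall i, C i (x i)].

Local Open Scope ereal_scope.

Definition partial_vol (C : nat -> set (measurableTypeR R)) (n : nat) : \bar R :=
  \prod_(i < n) lebesgue_measure (C i).

Definition finite_rect (C : nat -> set (measurableTypeR R)) : Prop :=
  (forall i, measurable (C i)) /\
  exists r : R, partial_vol C @ \oo --> r%:E.

Definition vol (C : nat -> set (measurableTypeR R)) : \bar R :=
  lim (partial_vol C @ \oo).

(* outer measure mu^* ; inf of the empty set is +oo *)
Definition mu_star (A : set (nat -> R)) : \bar R :=
  ereal_inf [set \sum_(0 <= n <oo) vol (C n) |
    C in [set C : nat -> nat -> set (measurableTypeR R) |
            (forall n, finite_rect (C n)) /\ A `<=` \bigcup_n rect (C n)]].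

Local Close Scope ereal_scope.

Definition cube (a : nat -> int) : set RN :=
  [set x | forall n, (a n)%:~R <= x n < (a n)%:~R + 1].

(* membership in B^p (as functions; L^p-elements are taken up to m-a.e. equality) *)
Definition Bp (m : {measure set RN -> \bar R}) (p : R) (f : RN -> R) : Prop :=
  f \in Lfun m p%:E /\
  forall a : nat -> int, (\int[m]_(x in cube a) (`|f x| `^ p)%:E)%E = 0%E.

Definition lambda01 : {measure set (measurableTypeR R) -> \bar R} :=
  mrestr (@lebesgue_measure R) (measurable_itv `[0%R, 1%R]).

(* l^p(c, L^p[0,1]) : families indexed by R (|R| = c) *)
Definition ellp_norm (p : R) (g : R -> measurableTypeR R -> R) : \bar R :=
  ((\esum_(i in [set: R]) ('N[lambda01]_(p%:E)[EFin \o g i] `^ p)) `^ p^-1)%E.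

Definition ellp (p : R) (g : R -> measurableTypeR R -> R) : Prop :=
  (forall i, g i \in Lfun lambda01 p%:E) /\ (ellp_norm p g < +oo)%E.

End InfiniteProduct.

(* Main.v *)
Require Import Defs.
From HB Require Import structures.
From mathcomp Require Import all_boot all_order all_algebra.
From mathcomp Require Import finmap.
From mathcomp Require Import all_classical all_reals all_analysis.
From mathcomp Require Import measurable_realfun lra.
Set Implicit Arguments. Unset Strict Implicit. Unset Printing Implicit Defensive.
Import Order.TTheory GRing.Theory Num.Theory.
Import numFieldNormedType.Exports.
Local Open Scope classical_set_scope.
Local Open Scope ring_scope.

(** For each real [i] let [E_i] be the product of [[0, 1]] and of the intervals
    [[k_n + 1/2, k_n + 3/2[] with [k_n = floor (i * n)], [n >= 1]. The [E_i] are
    disjoint, each has measure 1, and each meets every cube in a null set, since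
    an integer interval covers at most half of a side. On [E_i] the measure
    is the product of [lambda] on [[0, 1]] and of its restriction to the product
    of the remaining sides. The embedding sends [(g_i)] to the function equal to
    [g_i (y_0)] on [E_i]; the projection averages a function on each [E_i] over
    all coordinates but the first, a contraction by Jensen's inequality.

    That [mu^* (E_i) >= 1] is proved by truncating a cover of total volume less
    than 1 to cylinders and choosing the coordinates of an uncovered point one
    at a time: by Fubini, some choice keeps the total volume of the rectangles
    still met below 1. The product structure on [E_i] then needs no uniqueness
    theorem: the product measure is below the volume on finite rectangles, hence
    below [mu^*], and it has the same total mass as the measure on [E_i]. *)

Section energy.
Context d (T : measurableType d) (R : realType).
Variables (mu : {measure set T -> \bar R}) (p : R).
Local Open Scope ereal_scope.
Implicit Types (D : set T) (f : T -> R).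

Definition energy D f : \bar R := \int[mu]_(x in D) (`|f x| `^ p)%:E.

Lemma energy_ge0 D f : 0 <= energy D f.
Proof. by apply: integral_ge0 => x _; rewrite lee_fin powR_ge0. Qed.

Lemma measurable_norm_powR D f : measurable_fun D f ->
  measurable_fun D (fun x => (`|f x| `^ p)%:E).
Proof.
move=> mf; apply/measurable_EFinP.
apply: (@measurableT_comp _ _ _ _ _ _ (@powR R ^~ p)) => //.
exact: measurableT_comp.
Qed.

Lemma eq_energy D f g : {in D, f =1 g} -> energy D f = energy D g.
Proof. by move=> fg; apply: eq_integral => x /fg ->. Qed.

Lemma energy_subset D D' f : measurable D -> measurable D' -> D `<=` D' ->
  measurable_fun D' f -> energy D f <= energy D' f.
Proof.
move=> mD mD' DD' mf; apply: ge0_subset_integral => //.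
exact: measurable_norm_powR.
Qed.

Lemma Lnorm_energy f : 'N[mu]_(p%:E)[EFin \o f] = energy setT f `^ p^-1.
Proof. by rewrite unlock. Qed.

Hypothesis p0 : (0 < p)%R.

Lemma energy_supp D f : (forall x, ~ D x -> f x = 0%R) ->
  energy setT f = energy D f.
Proof.
move=> f0; rewrite /energy [RHS]integral_mkcond; apply: eq_integral => x _.
rewrite patchE; case: ifPn => //; rewrite notin_setE => /f0 ->.
by rewrite normr0 powR0// gt_eqF.
Qed.

Lemma energy_eq0P D f : measurable D -> measurable_fun D f ->
  energy D f = 0 <-> f = cst 0%R %[ae mu in D].
Proof.
move=> mD mf; have -> : energy D f = \int[mu]_(x in D) `|(`|f x| `^ p)%:E|.
  by apply: eq_integral => x _; rewrite gee0_abs// lee_fin powR_ge0.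
rewrite ae_eq_integral_abs//; last exact: measurable_norm_powR.
split; apply: filterS => x /[apply].
  by move=> [/powR_eq0_eq0/normr0_eq0].
by move=> ->; rewrite normr0 powR0// gt_eqF.
Qed.

Lemma Lfun_energyP f :
  f \in Lfun mu p%:E <-> measurable_fun setT f /\ energy setT f < +oo.
Proof.
split=> [|[mf fin]].
  rewrite inE => /andP[/[!inE]/= mf]; rewrite /finite_norm Lnorm_energy.
  move=> /(poweR_lty p); rewrite -poweRrM mulVf ?gt_eqF// poweRe1//.
  exact: energy_ge0.
rewrite inE; apply/andP; split; rewrite inE//=.
by rewrite /finite_norm Lnorm_energy poweR_lty.
Qed.

Lemma ae_eq_Lfun f g : f \in Lfun mu p%:E -> measurable_fun setT g ->
  f = g %[ae mu] -> g \in Lfun mu p%:E.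
Proof.
move=> /Lfun_energyP[mf fin] mg fg; apply/Lfun_energyP; split=> //.
rewrite /energy (ae_eq_integral (fun x => (`|f x| `^ p)%:E)) => //.
- exact: measurable_norm_powR.
- exact: measurable_norm_powR.
- by apply: filterS fg => x /[apply] ->.
Qed.

End energy.

(* [fine] turns an undefined or infinite integral into [0], so that no
   integrability assumption is needed *)
Lemma powR_integral_le_energy d (T : measurableType d) (R : realType)
    (P : probability T R) (p : R) (f : T -> R) :
  1 <= p -> measurable_fun setT f ->
  ((`|fine (\int[P]_x (f x)%:E)| `^ p)%:E <= energy P p setT f)%E.
Proof.
move=> p1 mf; have p0 : 0 < p by rewrite (lt_le_trans ltr01).
have L1_le_Lp : (\int[P]_x `|(f x)%:E| <= 'N[P]_p%:E[EFin \o f])%E.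
  have [->|pn1] := eqVneq p 1; first by rewrite Lnorm1.
  have q0 : 0 < (1 - p^-1)^-1.
    by rewrite invr_gt0 subr_gt0 invf_lt1// lt_neqAle eq_sym pn1.
  have := @hoelder _ _ _ P f (cst 1) p (1 - p^-1)^-1 mf _ p0 q0.
  rewrite invrK subrKC => /(_ (measurable_cst _) erefl).
  rewrite Lnorm_cst1 [X in (X `^ _)%E]probability_setT poweR1r mule1 Lnorm1.
  by under eq_integral do rewrite /= mulr1.
have /measurable_EFinP mEf := mf.
have -> : energy P p setT f = ('N[P]_p%:E[EFin \o f] `^ p)%E.
  by rewrite poweR_Lnorm// gt_eqF.
rewrite -poweR_EFin; apply: gt0_ler_poweR => //.
- exact: ltW.
- by rewrite in_itv/= leey lee_fin normr_ge0.
- by rewrite in_itv/= leey Lnorm_ge0.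
apply: le_trans L1_le_Lp; apply: le_trans (le_abse_integral P measurableT mEf).
by case: (integral _ _ _) => [r| |]//=; rewrite ?normr0 ?leey ?lexx.
Qed.

Section section_average.
Context d1 d2 (T1 : measurableType d1) (T2 : measurableType d2) (R : realType).
Variables (mu : {finite_measure set T1 -> \bar R}) (P : probability T2 R).
Variable p : R.
Hypothesis p1 : 1 <= p.
Local Open Scope ereal_scope.

Let p0 : (0 < p)%R. Proof. exact: lt_le_trans ltr01 p1. Qed.

Implicit Types f g : T1 * T2 -> R.

Definition section_average f (x : T1) : R := fine (\int[P]_y (f (x, y))%:E).

Lemma product_measure_fin_numT : (mu \x P) setT \is a fin_num.
Proof. by rewrite -setXTT product_measure1E// fin_numM// fin_num_measure. Qed.

Lemma Lfun_product_integrable f :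
  f \in Lfun (mu \x P) p%:E -> (mu \x P).-integrable setT (EFin \o f).
Proof.
move=> Lf; apply/Lfun1_integrable; apply: Lfun_subset Lf => //.
exact: product_measure_fin_numT.
Qed.

Lemma measurable_section_average f :
  f \in Lfun (mu \x P) p%:E -> measurable_fun setT (section_average f).
Proof.
move=> Lf; apply: (@measurableT_comp _ _ _ _ _ _ (@fine R)).
  exact: fine_measurable.
exact: (measurable_fubini_F (Lfun_product_integrable Lf)).
Qed.

Lemma energy_section_average_le f : f \in Lfun (mu \x P) p%:E ->
  energy mu p setT (section_average f) <= energy (mu \x P) p setT f.
Proof.
move=> Lf; have [mf _] := (Lfun_energyP (mu \x P) p0 f).1 Lf.
have mfp := measurable_norm_powR p mf.
have fp0 z : 0 <= (`|f z| `^ p)%:E by rewrite lee_fin powR_ge0.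
rewrite /energy (fubini_tonelli1 (fun z => (`|f z| `^ p)%:E))//.
apply: ge0_le_integral => //.
- exact/measurable_norm_powR/measurable_section_average.
- exact: (measurable_fun_fubini_tonelli_F (fun z => (`|f z| `^ p)%:E)).
- move=> x _; apply: powR_integral_le_energy => //.
  exact: (measurableT_comp mf).
Qed.

Lemma section_average_linear f g (a : R) :
  f \in Lfun (mu \x P) p%:E -> g \in Lfun (mu \x P) p%:E ->
  section_average (fun z => a * f z + g z)%R =
  (fun x => a * section_average f x + section_average g x)%R %[ae mu].
Proof.
move=> Lf Lg.
have := ae_integrable1 (Lfun_product_integrable Lf).
have := ae_integrable1 (Lfun_product_integrable Lg).
apply: filterS2 => x intg intf _; rewrite /section_average.
under eq_integral do rewrite EFinD EFinM.
rewrite integralD//; last exact: integrableZl.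
rewrite integralZl// fineD ?fineM//.
- exact: integrable_fin_num.
- by rewrite fin_numM//; exact: integrable_fin_num.
- exact: integrable_fin_num.
Qed.

Lemma ae_eq_section_average f g :
  f \in Lfun (mu \x P) p%:E -> g \in Lfun (mu \x P) p%:E ->
  f = g %[ae mu \x P] -> section_average f = section_average g %[ae mu].
Proof.
move=> Lf Lg fg; pose h z := (-1 * g z + f z)%R.
have Lh : h \in Lfun (mu \x P) p%:E.
  by have [_ ->] := Lfun_submod_closed (mu \x P) (p1 : 1 <= p%:E).
have [mh _] := (Lfun_energyP _ p0 h).1 Lh.
have h0 : energy (mu \x P) p setT h = 0.
  apply/(energy_eq0P _ p0 measurableT mh); apply: filterS fg => z /[apply].
  by rewrite /h => ->; rewrite mulN1r addNr.
have : section_average h = cst 0%R %[ae mu].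
  apply/(energy_eq0P _ p0 measurableT (measurable_section_average Lh)).
  by apply/eqP; rewrite eq_le energy_ge0 -[leRHS]h0 energy_section_average_le.
have := section_average_linear (-1) Lg Lf; apply: filterS2 => x + + xT.
by move=> /(_ xT) -> /(_ xT)/eqP; rewrite mulN1r addrC subr_eq0 => /eqP.
Qed.

End section_average.

Lemma countable_setU (I : Type) (A B : set I) :
  countable A -> countable B -> countable (A `|` B).
Proof.
move=> cA cB; rewrite -bigcup2inE.
by apply: bigcup_countable => [|[|[|n]]//]; exact: countableP.
Qed.

Lemma countable_partition1 (I : choiceType) (S : set I) : countable S ->
  exists u : nat -> set I, [/\ S = \bigcup_n u n, trivIset setT u &
    forall n, u n = set0 \/ exists i, u n = [set i]].
Proof.
move=> /countable_injP[c c_inj]; exists (fun n => S `&` c @^-1` [set n]); split.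
- by apply/seteqP; split => [i Si|i [n _ []]//]; exists (c i).
- by move=> n k _ _ [i [[_ /= <-] [_ /= <-]]].
- move=> n; have [->|] := eqVneq (S `&` c @^-1` [set n]) set0; first by left.
  move=> /set0P[i [Si /= cin]].
  right; exists i; apply/seteqP; split => [j [Sj /= cjn]|j /= ->//].
  by apply: c_inj; rewrite ?inE// cin cjn.
Qed.

Section countable_bigcup.
Context d (T : measurableType d) (R : realType).
Variable mu : {measure set T -> \bar R}.
Variables (I : choiceType) (S : set I) (E : I -> set T).
Hypothesis cS : countable S.
Local Open Scope ereal_scope.

Lemma ae_countable_bigcup (Q : T -> Prop) :
  (forall i, S i -> \forall x \ae mu, E i x -> Q x) ->
  \forall x \ae mu, (\bigcup_(i in S) E i) x -> Q x.
Proof.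
have [u [-> _ u1]] := countable_partition1 cS => EQ.
have : \forall x \ae mu, forall n i, u n i -> E i x -> Q x.
  apply: ae_foralln => n; have [->|[i un]] := u1 n; first exact: aeW.
  rewrite un; have : \forall x \ae mu, E i x -> Q x.
    by apply: EQ; exists n => //; rewrite un.
  by apply: filterS => x EQx j ->.
by apply: filterS => x EQx [i [n _ uni]]; exact: EQx uni.
Qed.

Hypothesis mE : forall i, measurable (E i).

Lemma countable_bigcup_measurable : measurable (\bigcup_(i in S) E i).
Proof.
have [u [-> _ u1]] := countable_partition1 cS.
rewrite bigcup_bigcup; apply: bigcup_measurable => n _.
by have [->|[i ->]] := u1 n; rewrite ?bigcup_set0 ?bigcup_set1.
Qed.

Lemma measurable_fun_countable_bigcup d' (U : measurableType d') (f : T -> U) :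
  (forall i, S i -> measurable_fun (E i) f) ->
  measurable_fun (\bigcup_(i in S) E i) f.
Proof.
have [u [-> _ u1]] := countable_partition1 cS => mf.
rewrite bigcup_bigcup; apply/measurable_fun_bigcup => n.
  by have [->|[i ->]] := u1 n; rewrite ?bigcup_set0 ?bigcup_set1.
have [->|[i uni]] := u1 n; rewrite ?uni ?bigcup_set0 ?bigcup_set1.
  exact: measurable_fun_set0.
by apply: mf; exists n => //; rewrite uni.
Qed.

Lemma ge0_integral_countable_bigcup (f : T -> \bar R) : trivIset S E ->
  measurable_fun setT f -> (forall x, 0 <= f x) ->
  \int[mu]_(x in \bigcup_(i in S) E i) f x =
  \esum_(i in S) \int[mu]_(x in E i) f x.
Proof.
move=> tE mf f0; move: tE.
have [u [-> tu u1]] := countable_partition1 cS => tE.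
rewrite nneseries_sum_bigcup//; last by move=> i; exact: integral_ge0.
rewrite bigcup_bigcup ge0_integral_bigcup//.
- apply: eq_eseriesr => n _.
  have [->|[i ->]] := u1 n.
    by rewrite bigcup_set0 integral_set0 esum_set0.
  by rewrite bigcup_set1 esum_set1//; exact: integral_ge0.
- by move=> n; have [->|[i ->]] := u1 n; rewrite ?bigcup_set0 ?bigcup_set1.
- exact: measurable_funTS.
- move=> n k _ _ [x [[i ui Eix] [j uj Ejx]]].
  have ij : i = j by apply: tE; [exists n|exists k|exists x].
  by apply: tu => //; exists i; split=> //; rewrite ij.
Qed.

End countable_bigcup.

Lemma ge0_integral_mrestr d (T : measurableType d) (R : realType)
    (mu : {measure set T -> \bar R}) (D : set T) (mD : measurable D)
    (f : T -> \bar R) :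
  measurable_fun setT f -> (forall x, 0 <= f x)%E ->
  (\int[mrestr mu mD]_x f x = \int[mu]_(x in D) f x)%E.
Proof.
move=> mf f0.
rewrite (@ge0_negligible_integral _ _ _ _ setT (~` D))//; first last.
- by rewrite /= /mrestr setICl measure0.
- exact: measurableC.
rewrite setTD setCK; apply: eq_measure_integral => A mA AD.
by rewrite /= /mrestr setIidl.
Qed.

Lemma esum_integral_le d (T : measurableType d) (R : realType)
    (mu : {measure set T -> \bar R}) (I : choiceType) (E : I -> set T)
    (f : T -> \bar R) :
  (forall i, measurable (E i)) -> trivIset setT E ->
  measurable_fun setT f -> (forall x, 0 <= f x)%E ->
  (\esum_(i in setT) \int[mu]_(x in E i) f x <= \int[mu]_x f x)%E.
Proof.
move=> mE tE mf f0; apply: ub_ereal_sup => _ [A [finA _] <-].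
have cA := finite_set_countable finA.
rewrite -esum_fset//; last by move=> i _; exact: integral_ge0.
rewrite -ge0_integral_countable_bigcup//; last exact: sub_trivIset tE.
by apply: ge0_subset_integral => //; exact: countable_bigcup_measurable.
Qed.

Section summable_support.
Context (R : realType) (I : choiceType) (a : I -> \bar R).
Hypothesis a_ge0 : (forall i, 0 <= a i)%E.
Hypothesis a_summable : (\esum_(i in setT) a i < +oo)%E.

Lemma summable_superlevel_finite (e : R) :
  0 < e -> finite_set [set i | e%:E <= a i]%E.
Proof.
move=> e0; apply: contrapT => inf.
have sum_fin : (\esum_(i in setT) a i)%E \is a fin_num.
  by rewrite ge0_fin_numE// esum_ge0.
set s := fine (\esum_(i in setT) a i)%E.
have s0 : 0 <= s by rewrite fine_ge0// esum_ge0.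
have [B Ba sizeB] := infinite_set_fset (Num.bound (s / e)) inf.
have : (\sum_(i <- B) e%:E <= s%:E)%E.
  apply: (@le_trans _ _ (\sum_(i <- B) a i)%E).
    by rewrite big_seq [leRHS]big_seq; apply: lee_sum => i /Ba.
  rewrite fineK//; apply: esum_ge; exists [set` B]; first by split.
  by rewrite fsbig_finite//= set_fsetK.
apply/negP; rewrite -ltNge sumEFin lte_fin big_const_seq count_predT.
rewrite iter_addr_0 -mulr_natl -ltr_pdivrMr// (lt_le_trans (archi_boundP _))//.
  by rewrite divr_ge0// ltW.
by rewrite ler_nat.
Qed.

Lemma summable_support_countable : countable [set i | a i != 0%E].
Proof.
have -> : [set i | a i != 0%E] = \bigcup_n [set i | (n.+1%:R^-1)%:E <= a i]%E.
  apply/seteqP; split => [i /= ai|i [n _ /=] + ]; last first.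
    by apply: contraTneq => ->; rewrite -ltNge lte_fin invr_gt0.
  have ai0 : (0 < a i)%E by rewrite lt0e ai a_ge0.
  case ari : (a i) ai0 => [r|//|//]; last first.
    by exists 0%N => //=; rewrite ari leey.
  rewrite lte_fin => /ltr_add_invr[n]; rewrite add0r => /ltW nr.
  by exists n => //=; rewrite ari lee_fin.
apply: bigcup_countable => [|n _]; first exact: countableP.
apply: finite_set_countable; apply: summable_superlevel_finite.
by rewrite invr_gt0.
Qed.

End summable_support.

Section probability_restriction.
Context d (T : measurableType d) (R : realType).
Variables (mu : {measure set T -> \bar R}) (D : set T).
Variables (mD : measurable D) (muD : mu D = 1%E).

Definition prestr of mu D = 1%E : set T -> \bar R := mrestr mu mD.

Local Notation restr := (prestr muD).

HB.instance Definition _ := Measure.on restr.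

Let prestr_setT : restr setT = 1%E.
Proof. by rewrite /restr /mrestr setTI. Qed.

HB.instance Definition _ := Measure_isProbability.Build _ _ _ restr prestr_setT.

End probability_restriction.

Lemma eq_measure_le_mass d (T : measurableType d) (R : realType)
    (mu nu : {measure set T -> \bar R}) :
  (forall A, measurable A -> mu A <= nu A)%E -> (nu setT <= mu setT)%E ->
  (nu setT < +oo)%E -> forall A, measurable A -> mu A = nu A.
Proof.
move=> le_mu_nu le_mass nu_fin A mA; have mAC := measurableC mA.
apply/eqP; rewrite eq_le le_mu_nu//= leNgt; apply/negP => lt_mu_nu.
move: le_mass; apply/negP; rewrite -ltNge -(setvU A) !measureU ?setICl//.
rewrite lee_ltD ?le_mu_nu// ge0_fin_numE// (le_lt_trans _ nu_fin)//.
by rewrite (le_trans (le_mu_nu _ mAC))// le_measure ?inE.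
Qed.

Lemma exists_lt_average d (T : measurableType d) (R : realType)
    (mu : {measure set T -> \bar R}) (D : set T)
    (f : T -> \bar R) (r : \bar R) :
  measurable D -> measurable_fun D f -> (forall x, 0 <= f x)%E -> (0 <= r)%E ->
  (\int[mu]_(x in D) f x < r * mu D)%E -> exists2 x, D x & (f x < r)%E.
Proof.
move=> mD mf f0 r0; apply: contraPP => /forall2NP no_point.
apply/negP; rewrite -leNgt -integral_cst//; apply: ge0_le_integral => // x Dx.
by rewrite leNgt; apply/negP; have [] := no_point x.
Qed.

Lemma lee_prod (R : realDomainType) (I : Type) (r : seq I) (P : pred I)
    (f g : I -> \bar R) :
  (forall i, P i -> 0 <= f i)%E -> (forall i, P i -> f i <= g i)%E ->
  (\prod_(i <- r | P i) f i <= \prod_(i <- r | P i) g i)%E.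
Proof.
move=> f0 fg; suff /andP[] :
  (0 <= \prod_(i <- r | P i) f i <= \prod_(i <- r | P i) g i)%E by [].
elim/big_rec2 : _ => [|i x y Pi /andP[y0 yx]]; first by rewrite lee01 lexx.
by rewrite mule_ge0 ?f0//= lee_pmul ?f0 ?fg.
Qed.

Section disjoint_copies.
Context d d' (T : measurableType d) (X : measurableType d') (R : realType).
Context (I : choiceType).
Variables (m : {measure set T -> \bar R}) (nu : {measure set X -> \bar R}).
Variables (E : I -> set T) (q : {mfun T >-> X}).

Record disjoint_copies : Prop := DisjointCopies {
  copy_measurable : forall i, measurable (E i) ;
  copies_disjoint : trivIset setT E ;
  copy_law : forall i A, measurable A -> m (E i `&` q @^-1` A) = nu A }.

Variable p : R.
Local Open Scope ereal_scope.
Implicit Types g h k : I -> X -> R.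

Definition active g : set I := [set i | energy nu p setT (g i) != 0].

(* Outside the pieces on which [g] is active the value is [0]: the sum over all
   the pieces need not be measurable. *)
Definition copies_embed g (y : T) : R :=
  (\sum_(i \in active g) \1_(E i) y * g i (q y))%R.

Definition lp_sum g : Prop :=
  (forall i, measurable_fun setT (g i)) /\
  \esum_(i in setT) energy nu p setT (g i) < +oo.

Lemma countable_active g : lp_sum g -> countable (active g).
Proof.
by move=> [_]; apply: summable_support_countable => i; exact: energy_ge0.
Qed.

Lemma copies_embed_out g y :
  ~ (\bigcup_(i in active g) E i) y -> copies_embed g y = 0%R.
Proof.
move=> ny; apply: fsbig1 => i gi; rewrite indicE memNset ?mul0r// => Eiy.
by apply: ny; exists i.
Qed.

Hypothesis copiesP : disjoint_copies.
Hypothesis p0 : (0 < p)%R.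

Let mE := copy_measurable copiesP.

Lemma copies_embed_in g i y : E i y ->
  copies_embed g y = if i \in active g then g i (q y) else 0%R.
Proof.
move=> Eiy; have only_i j : E j y -> j = i.
  by move=> Ejy; apply: (copies_disjoint copiesP) => //; exists y.
case: ifPn => [/set_mem gi|]; last first.
  rewrite notin_setE => gi; apply: copies_embed_out => -[j gj /only_i ji].
  by apply: gi; rewrite -ji.
rewrite /copies_embed -(fsbig_widen [set i]); last 2 first.
- by move=> _ ->.
- move=> j [_ /= ji]; rewrite indicE memNset ?mul0r//.
  by move=> /only_i.
by rewrite fsbig_set1 indicE mem_set// mul1r.
Qed.

Lemma ae_copy i (Q : X -> Prop) : (\forall x \ae nu, Q x) ->
  \forall y \ae m, E i y -> Q (q y).
Proof.
move=> [A [mA A0 QA]]; exists (E i `&` q @^-1` A); split.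
- by apply: measurableI => //; exact: measurable_funPTI.
- by rewrite copy_law.
- by move=> y /= /not_implyP[Eiy nQ]; split => //; exact: QA.
Qed.

Lemma ge0_integral_copy i (f : X -> \bar R) :
  measurable_fun setT f -> (forall x, 0 <= f x) ->
  \int[m]_(y in E i) f (q y) = \int[nu]_x f x.
Proof.
move=> mf f0; have mfq : measurable_fun setT (f \o q).
  exact: measurableT_comp.
have := @ge0_integral_pushforward _ _ _ _ _ _ (measurable_funPT q)
  (mrestr m (mE i)) setT f measurableT mf (fun x _ => f0 x).
rewrite preimage_setT (ge0_integral_mrestr _ _ mfq)//= => <-.
apply: eq_measure_integral => A mA _.
by rewrite /= /pushforward /mrestr setIC (copy_law copiesP).
Qed.

Lemma energy_copies_embed g i : (forall j, measurable_fun setT (g j)) ->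
  energy m p (E i) (copies_embed g) = energy nu p setT (g i).
Proof.
move=> mg; case: (boolP (i \in active g)) => gi.
  rewrite (@eq_energy _ _ _ _ _ _ _ (g i \o q)); last first.
    by move=> y /set_mem Eiy; rewrite (copies_embed_in g Eiy) gi.
  apply: (@ge0_integral_copy i (fun x => (`|g i x| `^ p)%:E)).
    exact: measurable_norm_powR.
  by move=> x; rewrite lee_fin powR_ge0.
have /eqP-> : energy nu p setT (g i) == 0.
  by apply: contraNT gi => gi; exact/mem_set.
rewrite (@eq_energy _ _ _ _ _ _ _ (cst 0%R)); last first.
  by move=> y /set_mem Eiy; rewrite (copies_embed_in g Eiy) (negbTE gi).
by apply/(energy_eq0P _ p0 (mE i)) => //; exact: ae_eq_refl.
Qed.

Lemma measurable_copies_embed g :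
  lp_sum g -> measurable_fun setT (copies_embed g).
Proof.
move=> lg; have cg := countable_active lg; have [mg _] := lg.
have mU := countable_bigcup_measurable cg mE.
rewrite -(setUv (\bigcup_(i in active g) E i)); apply/measurable_funU => //.
  exact: measurableC.
split.
  apply: measurable_fun_countable_bigcup => // i gi.
  apply: (@eq_measurable_fun _ _ _ _ _ (g i \o q)).
    by move=> y /set_mem Eiy; rewrite (copies_embed_in g Eiy) mem_set.
  by apply: measurable_funTS; exact: measurableT_comp.
apply: (@eq_measurable_fun _ _ _ _ _ (cst (0 : R)%R)) => // y /set_mem ny.
by rewrite copies_embed_out.
Qed.

Lemma energyT_copies_embed g : lp_sum g ->
  energy m p setT (copies_embed g) = \esum_(i in setT) energy nu p setT (g i).
Proof.
move=> lg; have cg := countable_active lg; have [mg _] := lg.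
have mJ := measurable_norm_powR p (measurable_copies_embed lg).
rewrite (energy_supp _ p0 (copies_embed_out (g := g))) /energy.
rewrite ge0_integral_countable_bigcup//.
- rewrite esum_mkcond; apply: eq_esum => i _.
  rewrite -/(energy m p (E i) _) energy_copies_embed//; case: ifPn => //.
  by rewrite notin_setE => /negP/negPn/eqP.
- exact: sub_trivIset (copies_disjoint copiesP).
Qed.

Lemma Lnorm_copies_embed g : lp_sum g -> 'N[m]_(p%:E)[EFin \o copies_embed g] =
  (\esum_(i in setT) energy nu p setT (g i)) `^ p^-1.
Proof. by move=> lg; rewrite Lnorm_energy energyT_copies_embed. Qed.

Lemma copies_embed_Lfun g : lp_sum g -> copies_embed g \in Lfun m p%:E.
Proof.
move=> lg; apply/Lfun_energyP => //.
by rewrite energyT_copies_embed//; have [] := lg; split;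
  first exact: measurable_copies_embed.
Qed.

Lemma energy_copies_embed_null g A : lp_sum g -> measurable A ->
  (forall i, m (E i `&` A) = 0) -> energy m p A (copies_embed g) = 0.
Proof.
move=> lg mA EA0; have mJ : measurable_fun A (copies_embed g).
  exact/measurable_funTS/measurable_copies_embed.
apply/(energy_eq0P _ p0 mA mJ).
have : \forall y \ae m, (\bigcup_(i in active g) E i) y -> ~ A y.
  apply: ae_countable_bigcup => [|i _]; first exact: countable_active.
  exists (E i `&` A); split; [exact: measurableI|exact: EA0|].
  by move=> y /= /not_implyP[Eiy /contrapT].
apply: filterS => y nA Ay; apply: copies_embed_out => Ey.
exact: nA Ey Ay.
Qed.

Lemma copies_embed_ae_in g i : measurable_fun setT (g i) ->
  copies_embed g = g i \o q %[ae m in E i].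
Proof.
move=> mgi; case: (boolP (i \in active g)) => gi.
  by apply: aeW => y Eiy; rewrite (copies_embed_in g Eiy) gi.
have : g i = cst 0%R %[ae nu].
  apply/(energy_eq0P _ p0 measurableT mgi)/eqP.
  by apply: contraNT gi => gi; exact/mem_set.
move=> /(ae_copy i); apply: filterS => y gi0 Eiy.
by rewrite (copies_embed_in g Eiy) (negbTE gi) /= gi0.
Qed.

Lemma copies_embed_ae_eq g (S : set I) (f : T -> R) :
  countable (active g) -> countable S ->
  (forall i, measurable_fun setT (g i)) ->
  (forall y, ~ (\bigcup_(i in S) E i) y -> f y = 0%R) ->
  (forall i, f = g i \o q %[ae m in E i]) -> copies_embed g = f %[ae m].
Proof.
move=> cg cS mg f_out f_in.
have : copies_embed g = f %[ae m in \bigcup_(i in active g `|` S) E i].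
  apply: ae_countable_bigcup => [|i _]; first exact: countable_setU.
  exact: ae_eq_trans (copies_embed_ae_in (mg i)) (ae_eq_sym (f_in i)).
apply: filterS => y eq_in _.
have [/eq_in//|nU] := pselect ((\bigcup_(i in active g `|` S) E i) y).
by rewrite copies_embed_out ?f_out// => -[i iS Eiy];
  apply: nU; exists i => //; by [left|right].
Qed.

Lemma ae_eq_copies_embed g h : lp_sum g -> lp_sum h ->
  (forall i, g i = h i %[ae nu]) -> copies_embed g = copies_embed h %[ae m].
Proof.
move=> lg lh gh; have [mg _] := lg; have [mh _] := lh.
apply: (copies_embed_ae_eq (S := active h)) => //.
- exact: countable_active.
- exact: countable_active.
- exact: copies_embed_out.
move=> i; have := ae_copy i (gh i); have := copies_embed_ae_in (mh i).
by apply: filterS2 => y + + Eiy => /(_ Eiy) -> /(_ Eiy) /= ->.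
Qed.

Lemma copies_embed_ae_linear g h k (a : R) : lp_sum g -> lp_sum h ->
  (forall i, measurable_fun setT (k i)) ->
  (forall i, k i = (fun x => a * g i x + h i x)%R %[ae nu]) ->
  copies_embed k = (fun y => a * copies_embed g y + copies_embed h y)%R %[ae m].
Proof.
move=> lg lh mk kE; have [mg _] := lg; have [mh _] := lh.
have cS : countable (active g `|` active h).
  by apply: countable_setU; exact: countable_active.
apply: (copies_embed_ae_eq (S := active g `|` active h)) => //.
- apply: sub_countable cS; apply: subset_card_le => i; apply: contraPP.
  move=> /not_orP[/negP/negPn/eqP gi0 /negP/negPn/eqP hi0] /=.
  apply/negP/negPn/eqP/(energy_eq0P _ p0 measurableT (mk i)).
  have := kE i.
  move/(energy_eq0P _ p0 measurableT (mg i)) : gi0.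
  move/(energy_eq0P _ p0 measurableT (mh i)) : hi0.
  apply: filterS3 => x + + + xT => /(_ xT) h0 /(_ xT) g0 /(_ xT) ->.
  by rewrite g0 h0 mulr0 addr0.
- move=> y nS; rewrite !copies_embed_out ?mulr0 ?addr0// => -[i gi Eiy];
    by apply: nS; exists i => //; by [left|right].
- move=> i; have := ae_copy i (kE i).
  have := copies_embed_ae_in (mh i); have := copies_embed_ae_in (mg i).
  by apply: filterS3 => y + + + Eiy => /(_ Eiy) -> /(_ Eiy) -> /(_ Eiy) /= ->.
Qed.

Lemma copies_embed_linear g h (a : R) : lp_sum g -> lp_sum h ->
  copies_embed (fun i x => a * g i x + h i x)%R =
  (fun y => a * copies_embed g y + copies_embed h y)%R %[ae m].
Proof.
move=> lg lh; apply: copies_embed_ae_linear => // i; last exact: ae_eq_refl.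
have [[mg _] [mh _]] := conj lg lh.
by apply: measurable_funD => //; exact: measurable_funM.
Qed.

End disjoint_copies.

Section copies_projection.
Context d d' d'' (T : measurableType d) (X : measurableType d')
  (Y : measurableType d'') (R : realType) (I : choiceType).
Variable m : {measure set T -> \bar R}.
Variable nu : {finite_measure set X -> \bar R}.
Variables (E : I -> set T) (q : {mfun T >-> X}) (P : I -> probability Y R).
Variable s : {mfun (X * Y)%type >-> T}.
Local Open Scope ereal_scope.

Record product_copies : Prop := ProductCopies {
  product_mapK : forall z, q (s z) = z.1 ;
  product_map_law : forall i A, measurable A ->
    (nu \x P i) (s @^-1` A) = m (E i `&` A) }.

Hypothesis productP : product_copies.

Lemma product_copies_disjoint_copies : (forall i, measurable (E i)) ->
  trivIset setT E -> disjoint_copies m nu E q.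
Proof.
move=> mE tE; split=> // i A mA; have mqA := measurable_funPTI q mA.
rewrite -(product_map_law productP)//.
have -> : s @^-1` (q @^-1` A) = A `*` setT.
  by apply/seteqP; split=> z; rewrite /= (product_mapK productP)// => -[].
by rewrite product_measure1E// [X in _ * X]probability_setT mule1.
Qed.

Hypothesis copiesP : disjoint_copies m nu E q.
Variable p : R.
Hypothesis p1 : (1 <= p)%R.
Implicit Types (f : T -> R) (g : I -> X -> R).
Local Notation embed := (copies_embed nu E q p).
Local Notation lp_sum := (lp_sum nu p).

Let mE := copy_measurable copiesP.
Let p0 : (0 < p)%R. Proof. exact: lt_le_trans ltr01 p1. Qed.

(* The conditional expectation of [f] given [q] on the copy [E i], as a function
   of the value of [q] *)
Definition copies_average f i : X -> R := section_average (P i) (f \o s).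

Lemma energy_comp_product_map f i : measurable_fun setT f ->
  energy (nu \x P i) p setT (f \o s) = energy m p (E i) f.
Proof.
move=> mf; have mfp := measurable_norm_powR p mf.
have fp0 y : 0 <= (`|f y| `^ p)%:E by rewrite lee_fin powR_ge0.
rewrite [RHS]/energy -(ge0_integral_mrestr m (mE i) mfp fp0).
have := @ge0_integral_pushforward _ _ _ _ _ _ (measurable_funPT s)
  (nu \x P i) setT _ measurableT mfp (fun y _ => fp0 y).
rewrite preimage_setT /energy => <-.
apply: eq_measure_integral => A mA _.
by rewrite /= /pushforward /mrestr setIC (product_map_law productP).
Qed.

Lemma Lfun_comp_product_map f i :
  f \in Lfun m p%:E -> f \o s \in Lfun (nu \x P i) p%:E.
Proof.
move=> /(Lfun_energyP _ p0)[mf fin]; apply/(Lfun_energyP _ p0).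
split; first exact: measurableT_comp.
rewrite energy_comp_product_map//; apply: le_lt_trans fin.
exact: energy_subset.
Qed.

Lemma ae_product_map i (Q : T -> Prop) :
  (\forall y \ae m, E i y -> Q y) -> \forall z \ae (nu \x P i), Q (s z).
Proof.
move=> [A [mA A0 QA]]; exists (s @^-1` (A `|` ~` E i)).
have mAEC : measurable (A `|` ~` E i).
  by apply: measurableU => //; exact: measurableC.
split; first exact: measurable_funPTI.
- rewrite (product_map_law productP)// setIUr setICr setU0.
  by apply: subset_measure0 A0 => //; exact: measurableI.
- move=> z /= nQ; have [Ez|] := pselect (E i (s z)); [left|by right].
  by apply: QA => /= /(_ Ez).
Qed.

Lemma measurable_copies_average f i :
  f \in Lfun m p%:E -> measurable_fun setT (copies_average f i).
Proof.
by move=> /(Lfun_comp_product_map i); exact: (measurable_section_average p1).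
Qed.

Lemma esum_energy_copies_average_le f : f \in Lfun m p%:E ->
  \esum_(i in setT) energy nu p setT (copies_average f i) <= energy m p setT f.
Proof.
move=> Lf; have [mf _] := (Lfun_energyP _ p0 f).1 Lf.
apply: (@le_trans _ _ (\esum_(i in setT) energy m p (E i) f)).
  apply: le_esum => i _; rewrite -energy_comp_product_map//.
  by apply: energy_section_average_le => //; exact: Lfun_comp_product_map.
apply: esum_integral_le => //; first exact: copies_disjoint copiesP.
exact: measurable_norm_powR.
Qed.

Lemma copies_average_lp_sum f : f \in Lfun m p%:E -> lp_sum (copies_average f).
Proof.
move=> Lf; split=> [i|]; first exact: measurable_copies_average.
by apply: le_lt_trans (esum_energy_copies_average_le Lf) _;
  have [] := (Lfun_energyP _ p0 f).1 Lf.
Qed.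

Lemma Lnorm_embed_average_le f : f \in Lfun m p%:E ->
  'N[m]_(p%:E)[EFin \o embed (copies_average f)] <= 'N[m]_(p%:E)[EFin \o f].
Proof.
move=> Lf; rewrite (Lnorm_copies_embed copiesP p0) ?Lnorm_energy; last first.
  exact: copies_average_lp_sum.
apply: gt0_ler_poweR.
- by rewrite invr_ge0 ltW.
- by rewrite in_itv/= leey esum_ge0// => i _; exact: energy_ge0.
- by rewrite in_itv/= leey energy_ge0.
- exact: esum_energy_copies_average_le.
Qed.

Lemma embed_average_linear f1 f2 (a : R) :
  f1 \in Lfun m p%:E -> f2 \in Lfun m p%:E ->
  embed (copies_average (fun y => a * f1 y + f2 y)%R) =
  (fun y => a * embed (copies_average f1) y +
            embed (copies_average f2) y)%R %[ae m].
Proof.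
move=> L1 L2; apply: (copies_embed_ae_linear copiesP p0).
- exact: copies_average_lp_sum.
- exact: copies_average_lp_sum.
- move=> i; apply: measurable_copies_average.
  by have [_ ->] := Lfun_submod_closed m (p1 : 1 <= p%:E).
- by move=> i; apply: (section_average_linear p1); exact: Lfun_comp_product_map.
Qed.

Lemma average_copies_embed g i : lp_sum g ->
  copies_average (embed g) i = g i %[ae nu].
Proof.
move=> lg; have [mg _] := lg; have LJ := copies_embed_Lfun copiesP p0 lg.
have embed_s : embed g \o s = g i \o fst %[ae nu \x P i].
  have := ae_product_map (copies_embed_ae_in copiesP p0 (mg i)).
  by apply: filterS => z /= -> _; rewrite (product_mapK productP).
have -> : g i = section_average (P i) (g i \o fst).
  apply/funext => x; rewrite /section_average/= integral_cst//.
  by rewrite [X in _ * X]probability_setT mule1.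
have Ls := Lfun_comp_product_map i LJ.
by apply: (ae_eq_section_average p1) (embed_s) => //;
  apply: (ae_eq_Lfun p0 Ls) embed_s; exact: measurableT_comp.
Qed.

Lemma embed_average_embed g : lp_sum g ->
  embed (copies_average (embed g)) = embed g %[ae m].
Proof.
move=> lg; have lJ := copies_average_lp_sum (copies_embed_Lfun copiesP p0 lg).
have averageK i := average_copies_embed i lg.
exact: (ae_eq_copies_embed copiesP p0 lJ lg averageK).
Qed.

End copies_projection.

Definition scons (T : Type) (a : T) (u : nat -> T) (n : nat) : T :=
  if n is k.+1 then u k else a.

Section measurable_sequences.
Variable R : realType.
Implicit Types C D : nat -> set (measurableTypeR R).

Definition coordinate (n : nat) (x : RN R) : measurableTypeR R := x n.

Lemma measurable_coordinate n : measurable_fun setT (coordinate n).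
Proof.
move=> _ A mA; rewrite setTI; apply: sub_sigma_algebra.
exists n.+1, (fun i => if i == n then A else setT); split.
  by move=> i; case: ifP.
apply/seteqP; split => x /=.
  by move=> Ax i _; case: eqP => // ->.
by move=> /(_ n (ltnSn n)); rewrite eqxx.
Qed.

HB.instance Definition _ (n : nat) :=
  isMeasurableFun.Build _ _ _ _ (coordinate n) (measurable_coordinate n).

Lemma measurable_RN d (T : measurableType d) (F : T -> RN R) :
  (forall n, measurable_fun setT (coordinate n \o F)) ->
  measurable_fun setT F.
Proof.
move=> mF; apply: (@measurability _ _ _ _ setT F (@cylinder R)) => //.
move=> _ [_ [m [C [mC ->]]] <-].
have -> : setT `&` F @^-1` [set x | forall i, (i < m)%N -> C i (x i)] =
    \bigcap_(i in [set k | (k < m)%N]) ((coordinate i \o F) @^-1` C i).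
  by rewrite setTI; apply/seteqP; split => z.
apply: bigcap_measurableType => i _; rewrite -[X in measurable X]setTI.
exact: mF.
Qed.

Definition cons_point (z : measurableTypeR R * RN R) : RN R := scons z.1 z.2.

Lemma measurable_cons_point : measurable_fun setT cons_point.
Proof.
apply: measurable_RN => -[|n]; first exact: measurable_fst.
exact: (measurableT_comp (measurable_coordinate n) measurable_snd).
Qed.

HB.instance Definition _ :=
  isMeasurableFun.Build _ _ _ _ cons_point measurable_cons_point.

Lemma rect_measurable C : (forall n, measurable (C n)) ->
  measurable (rect C : set (RN R)).
Proof.
move=> mC.
have -> : rect C = \bigcap_n (coordinate n @^-1` C n).
  by apply/seteqP; split => [x Cx n _|x Cx n]; [exact: Cx|exact: (Cx n)].
by apply: bigcap_measurableType => n _; exact: measurable_funPTI.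
Qed.

Lemma rectI C D : rect C `&` rect D = rect (fun n => C n `&` D n).
Proof.
apply/seteqP; split => [x [Cx Dx] n|x CDx]; first by split.
by split => n; have [] := CDx n.
Qed.

Lemma preimage_cons_point_rect C :
  cons_point @^-1` rect C = C 0%N `*` (rect (fun n => C n.+1) : set (RN R)).
Proof.
apply/seteqP; split => -[a x] /=.
  by move=> Cx; split => [|n]; [exact: (Cx 0%N)|exact: (Cx n.+1)].
by move=> [Ca Cx] [|n]; [exact: Ca|exact: Cx].
Qed.

End measurable_sequences.

Section rect_volume.
Variable R : realType.
Implicit Types C D : nat -> set (measurableTypeR R).
Local Open Scope ereal_scope.

Lemma partial_vol_ge0 C n : 0 <= partial_vol C n.
Proof. by apply: prode_ge0 => i _; exact: measure_ge0. Qed.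

Lemma finite_rect_cvg C : finite_rect C -> cvgn (partial_vol C).
Proof. by move=> [_ [r Cr]]; apply/cvg_ex; exists r%:E. Qed.

Lemma vol_ge0 C : finite_rect C -> 0 <= vol C.
Proof.
move=> fC; apply: lime_ge; first exact: finite_rect_cvg.
by apply: nearW => n; exact: partial_vol_ge0.
Qed.

Lemma finite_rect_le1 C : (forall n, measurable (C n)) ->
  (forall n, lebesgue_measure (C n) <= 1) -> finite_rect C.
Proof.
move=> mC C1; split=> //.
have : nonincreasing_seq (partial_vol C).
  apply/nonincreasing_seqP => n.
  rewrite /partial_vol big_ord_recr/= -[leRHS]mule1.
  by apply: lee_wpmul2l => //; exact: partial_vol_ge0.
move=> /ereal_nonincreasing_cvgn; set l := ereal_inf _ => Cl.
exists (fine l); rewrite fineK//.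
have l0 : 0 <= l.
  by apply: le_ereal_inf_tmp => _ [n _ <-]; exact: partial_vol_ge0.
rewrite ge0_fin_numE// (@le_lt_trans _ _ 1) ?ltry//.
by apply: ereal_inf_lbound; exists 0%N => //; rewrite /partial_vol big_ord0.
Qed.

Lemma vol_le C D : finite_rect C -> finite_rect D ->
  (forall n, C n `<=` D n) -> vol C <= vol D.
Proof.
move=> fC fD CD; have [mC _] := fC; have [mD _] := fD.
apply: lee_lim; [exact: finite_rect_cvg|exact: finite_rect_cvg|].
apply: nearW => n; apply: lee_prod => i _; first exact: measure_ge0.
by apply: le_measure; rewrite ?inE.
Qed.

Lemma vol_unit C : (forall n, lebesgue_measure (C n) = 1) -> vol C = 1.
Proof.
move=> C1; rewrite /vol (_ : partial_vol C = cst 1); first exact: lim_cst.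
by apply/funext => n; rewrite /partial_vol big1.
Qed.

Lemma vol_scons (A : set (measurableTypeR R)) C :
  lebesgue_measure A \is a fin_num -> cvgn (partial_vol C) ->
  vol (scons A C) = lebesgue_measure A * vol C.
Proof.
move=> Afin cC; apply/cvg_lim => //; rewrite -cvg_shiftS.
rewrite (_ : [sequence _]_n = (fun n => lebesgue_measure A * partial_vol C n)).
  exact: cvgeZl.
by apply/funext => n /=; rewrite /partial_vol big_ord_recl.
Qed.

Lemma vol_lt1_eq0 C (r : R) : (r < 1)%R -> finite_rect C ->
  (forall n, lebesgue_measure (C n) <= r%:E) -> vol C = 0.
Proof.
move=> r1 fC Cr; have r0 : (0 <= r)%R.
  by rewrite -lee_fin (le_trans _ (Cr 0%N))// measure_ge0.
have r_cvg : (fun n => (r ^+ n)%:E) @ \oo --> 0.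
  by apply: cvg_EFin; [exact: nearW|apply: cvg_expr; rewrite ger0_norm].
apply/eqP; rewrite eq_le vol_ge0// andbT -(cvg_lim _ r_cvg)//.
apply: lee_lim; [exact: finite_rect_cvg|by apply/cvg_ex; exists 0|].
apply: nearW => n; apply: (@le_trans _ _ (\prod_(i < n) r%:E)).
  by apply: lee_prod => i _; first exact: measure_ge0.
by rewrite prodEFin lee_fin prodr_const card_ord.
Qed.

Lemma vol_set0 : vol (fun _ => set0 : set (measurableTypeR R)) = 0.
Proof.
apply: (@vol_lt1_eq0 _ 0) => //; last by move=> n; rewrite measure0.
by apply: finite_rect_le1 => n; rewrite ?measure0.
Qed.

Lemma mu_star_rect_le C : finite_rect C -> mu_star (rect C) <= vol C.
Proof.
move=> fC; apply: ereal_inf_lbound.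
exists (scons C (fun _ _ => set0)).
  split; last by move=> x Cx; exists 0%N.
  by case=> // n; apply: finite_rect_le1 => i //=; rewrite measure0.
rewrite (nneseries_split 0 1)//; last first.
  by case=> [|n] _ /=; rewrite ?vol_set0// vol_ge0.
by rewrite big_nat1 eseries0 ?adde0//; case=> // n _ _; exact: vol_set0.
Qed.

Lemma le_mu_star (mu : {measure set (RN R) -> \bar R}) (A : set (RN R)) :
  (forall D, finite_rect D -> mu (rect D) <= vol D) -> measurable A ->
  mu A <= mu_star A.
Proof.
move=> muD mA; apply: le_ereal_inf_tmp => _ [D [fD cover] <-].
have mD n : measurable (rect (D n) : set (RN R)).
  by apply: rect_measurable; have [] := fD n.
apply: le_trans (measure_sigma_subadditive mu mD mA cover) _.
by apply: lee_nneseries => // n _; exact: muD.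
Qed.

Lemma partial_vol_sum_lt (D : nat -> nat -> set (measurableTypeR R)) (r : R) :
  (forall n, finite_rect (D n)) -> \sum_(0 <= n <oo) vol (D n) < r%:E ->
  exists N : nat -> nat, \sum_(0 <= n <oo) partial_vol (D n) (N n) < r%:E.
Proof.
move=> fD sum_lt; have v0 n : 0 <= vol (D n) by exact: vol_ge0.
have sum_fin : \sum_(0 <= n <oo) vol (D n) \is a fin_num.
  by rewrite ge0_fin_numE ?nneseries_ge0// (lt_trans sum_lt)// ltry.
move: sum_lt; rewrite -(fineK sum_fin) lte_fin; set s := fine _ => sr.
pose e := ((r - s) / 2)%R; have e0 : (0 < e)%R by rewrite divr_gt0// subr_gt0.
have near_vol n :
    exists N, partial_vol (D n) N <= vol (D n) + (e / (2 ^ n.+1)%:R)%:E.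
  have en0 : (0 < e / (2 ^ n.+1)%:R)%R by rewrite divr_gt0// ltr0n expn_gt0.
  have [_ [v Dv]] := fD n; have volE : vol (D n) = v%:E by exact/cvg_lim.
  apply: contrapT => /forallNP no_near.
  have : vol (D n) + (e / (2 ^ n.+1)%:R)%:E <= vol (D n).
    apply: lime_ge; first exact: finite_rect_cvg.
    by apply: nearW => k; rewrite leNgt; apply/negP => /ltW/no_near.
  by rewrite volE -EFinD lee_fin leNgt ltrDl en0.
have [N NP] := choice near_vol; exists N.
apply: (@le_lt_trans _ _ (s + e)%:E); last first.
  by rewrite lte_fin -ltrBrDl /e ltr_pdivrMr// ltr_pMr ?subr_gt0// ltr1n.
rewrite EFinD fineK//; apply: le_trans (epsilon_trick xpredT v0 (ltW e0)).
apply: lee_nneseries => n; first by move=> _ _; exact: partial_vol_ge0.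
by move=> _; exact: NP.
Qed.

End rect_volume.

Section unit_rect_cover.
Variables (R : realType) (C : nat -> set (measurableTypeR R)).
Variables (D : nat -> nat -> set (measurableTypeR R)) (N : nat -> nat).
Hypothesis mC : forall k, measurable (C k).
Hypothesis C1 : forall k, lebesgue_measure (C k) = 1%E.
Hypothesis mD : forall n k, measurable (D n k).
Local Open Scope ereal_scope.

Definition truncated_side n k : set (measurableTypeR R) :=
  if (k < N n)%N then D n k else setT.

Definition tail_weight n k : \bar R :=
  \prod_(k <= i < N n) lebesgue_measure (C i `&` D n i).

Lemma tail_weight_ge0 n k : 0 <= tail_weight n k.
Proof. by apply: prode_ge0 => i _; exact: measure_ge0. Qed.

Lemma tail_weight_eq1 n k : (N n <= k)%N -> tail_weight n k = 1.
Proof. by move=> Nk; rewrite /tail_weight big_geq. Qed.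

Lemma tail_weight0_le n : tail_weight n 0 <= partial_vol (D n) (N n).
Proof.
rewrite /tail_weight /partial_vol big_mkord; apply: lee_prod => i _.
  exact: measure_ge0.
by rewrite measureIr.
Qed.

Lemma tail_weightS n k : tail_weight n k =
  tail_weight n k.+1 * lebesgue_measure (truncated_side n k `&` C k).
Proof.
rewrite /truncated_side; case: ltnP => [kN|Nk].
  by rewrite /tail_weight big_ltn// muleC setIC.
by rewrite setTI C1 mule1 !tail_weight_eq1// (leq_trans Nk).
Qed.

(* [S] is the set of the rectangles that contain the first [k] coordinates
   chosen so far *)
Lemma next_coordinate k (S : set nat) :
  \sum_(0 <= n <oo) tail_weight n k * (\1_S n)%:E < 1 ->
  exists2 x, C k x &
    \sum_(0 <= n <oo) tail_weight n k.+1 *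
      (\1_(S `&` [set n | truncated_side n k x]) n)%:E < 1.
Proof.
move=> lt1; have mside n : measurable (truncated_side n k).
  by rewrite /truncated_side; case: ifP.
pose c n := tail_weight n k.+1 * (\1_S n)%:E.
pose f x := \sum_(0 <= n <oo) c n * (\1_(truncated_side n k) x)%:E.
have c0 n : 0 <= c n by rewrite mule_ge0 ?tail_weight_ge0// lee_fin.
have term0 n x : 0 <= c n * (\1_(truncated_side n k) x)%:E.
  by rewrite mule_ge0// lee_fin.
have mindic n : measurable_fun (C k) (EFin \o \1_(truncated_side n k)).
  by apply/measurable_EFinP; exact: measurable_indic.
have mterm n :
    measurable_fun (C k) (fun x => c n * (\1_(truncated_side n k) x)%:E).
  by apply: measurable_funeM; exact: mindic.
have [x Cx fx] : exists2 x, C k x & f x < 1.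
  apply: (@exists_lt_average _ _ _ lebesgue_measure) => //.
  - exact: ge0_emeasurable_sum.
  - by move=> x; exact: nneseries_ge0.
  rewrite [X in _ * X]C1 mule1; congr (_ < 1): lt1.
  rewrite integral_nneseries//.
  apply: eq_eseriesr => n _; rewrite ge0_integralZl//; last exact: mindic.
  by rewrite integral_indic// tail_weightS muleAC.
exists x => //; congr (_ < 1): fx; apply: eq_eseriesr => n _.
by rewrite indicI EFinM muleA.
Qed.

Lemma exists_uncovered_point :
  \sum_(0 <= n <oo) partial_vol (D n) (N n) < 1 ->
  exists2 x : nat -> R, rect C x & forall n, ~ rect (D n) x.
Proof.
move=> sum_lt.
pose good k S := \sum_(0 <= n <oo) tail_weight n k * (\1_S n)%:E < 1.
have next kS : exists x, good kS.1 kS.2 -> C kS.1 x /\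
    good kS.1.+1 (kS.2 `&` [set n | truncated_side n kS.1 x]).
  have [/next_coordinate[x Cx xP]|] := pselect (good kS.1 kS.2).
    by exists x.
  by exists 0%R.
have [g gP] := choice next.
pose hit := fix hit k := if k is j.+1
  then hit j `&` [set n | truncated_side n j (g (j, hit j))] else setT.
pose x k := g (k, hit k).
have good_hit k : good k (hit k).
  elim: k => [|k IH]; last by have [] := gP (k, hit k) IH.
  apply: le_lt_trans sum_lt; apply: lee_nneseries => n.
    by move=> _ _; rewrite mule_ge0 ?tail_weight_ge0// lee_fin.
  by move=> _; rewrite indicT mule1 tail_weight0_le.
exists x => [k|n Dx]; first by have [] := gP (k, hit k) (good_hit k).
have hit_n k : hit k n.
  elim: k => //= k IH; split=> //=.
  by rewrite /truncated_side; case: ifP => // _; exact: Dx.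
have := good_hit (N n); apply/negP; rewrite -leNgt.
have t0 i : 0 <= tail_weight i (N n) * (\1_(hit (N n)) i)%:E.
  by rewrite mule_ge0 ?tail_weight_ge0// lee_fin.
apply: le_trans (nneseries_lim_ge n.+1 _) => //.
rewrite big_nat_recr//= tail_weight_eq1// mul1e indicE mem_set//.
by rewrite leeDr// sume_ge0.
Qed.

End unit_rect_cover.

Lemma mu_star_unit_rect_ge1 (R : realType)
    (C : nat -> set (measurableTypeR R)) :
  (forall k, measurable (C k)) -> (forall k, lebesgue_measure (C k) = 1%E) ->
  (1 <= mu_star (rect C))%E.
Proof.
move=> mC C1; apply: le_ereal_inf_tmp => _ [D [fD cover] <-].
rewrite leNgt; apply/negP => /(partial_vol_sum_lt fD)[N].
have mD n k : measurable (D n k) by have [] := fD n.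
by move=> /(exists_uncovered_point mC C1 mD)[x /cover[n _ Dx] /(_ n)].
Qed.

Section unit_rect.
Variables (R : realType) (m : {measure set (RN R) -> \bar R}).
Hypothesis m_mu_star : forall A : set (RN R), measurable A -> m A = mu_star A.
Local Open Scope ereal_scope.

Lemma measure_rect_le (C : nat -> set (measurableTypeR R)) :
  finite_rect C -> m (rect C) <= vol C.
Proof.
move=> fC; have [mC _] := fC.
by rewrite m_mu_star; [exact: mu_star_rect_le|exact: rect_measurable].
Qed.

Lemma measure_unit_rect (C : nat -> set (measurableTypeR R)) :
  (forall n, measurable (C n)) -> (forall n, lebesgue_measure (C n) = 1) ->
  m (rect C) = 1.
Proof.
move=> mC C1; apply/eqP; rewrite eq_le; apply/andP; split.
  rewrite -[leRHS](vol_unit C1); apply: measure_rect_le.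
  by apply: finite_rect_le1 => // n; rewrite C1.
by rewrite m_mu_star; [exact: mu_star_unit_rect_ge1|exact: rect_measurable].
Qed.

Variables (A : set (measurableTypeR R)) (C : nat -> set (measurableTypeR R)).
Hypotheses (mA : measurable A) (A1 : lebesgue_measure A = 1).
Hypotheses (mC : forall n, measurable (C n)).
Hypothesis C1 : forall n, lebesgue_measure (C n) = 1.

Local Notation nu := (prestr mA A1).
Local Notation P := (prestr (rect_measurable mC) (measure_unit_rect mC C1)).

Lemma cons_point_law_rect_le (D : nat -> set (measurableTypeR R)) :
  finite_rect D -> (nu \x P) (@cons_point R @^-1` rect D) <= vol D.
Proof.
move=> fD; have [mD _] := fD.
pose DC n := D n.+1 `&` C n.
have fDC : finite_rect DC.
  apply: finite_rect_le1 => n; first exact: measurableI.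
  by rewrite -(C1 n) measureIr.
have fDAC : finite_rect (scons (D 0%N `&` A) DC).
  apply: finite_rect_le1 => -[|n] /=.
  - exact: measurableI.
  - exact: measurableI.
  - by rewrite -A1 measureIr.
  - by rewrite -(C1 n) measureIr.
rewrite preimage_cons_point_rect product_measure1E//; last first.
  exact: rect_measurable.
rewrite /= /prestr /mrestr rectI.
apply: (@le_trans _ _ (lebesgue_measure (D 0%N `&` A) * vol DC)).
  by apply: lee_wpmul2l => //; exact: measure_rect_le.
rewrite -vol_scons; last exact: finite_rect_cvg.
  by apply: vol_le => // -[|n] x [].
rewrite ge0_fin_numE// (@le_lt_trans _ _ 1) ?ltry//.
by rewrite -A1 measureIr.
Qed.

Lemma cons_point_law (B : set (RN R)) : measurable B ->
  (nu \x P) (@cons_point R @^-1` B) = m (rect (scons A C) `&` B).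
Proof.
pose E : set (RN R) := rect (scons A C).
have mE : measurable E by apply: rect_measurable; case.
pose law : probability (RN R) R := distribution (nu \x P) (@cons_point R).
have lawP F : law F = (nu \x P) (@cons_point R @^-1` F) by [].
have mass : m E = 1 by apply: measure_unit_rect; case.
have lawE : law E = 1.
  rewrite lawP preimage_cons_point_rect.
  rewrite product_measure1E//=; last exact: rect_measurable.
  by rewrite /prestr /mrestr !setIid A1 measure_unit_rect// mule1.
have lawEC : law (~` E) = 0 by rewrite probability_setC// lawE subee.
have lawI F : measurable F -> law F = law (F `&` E).
  move=> mF; rewrite [LHS](measureDI law mF mE).
  rewrite [X in X + _](_ : _ = 0) ?add0e//.
  apply: (@subset_measure0 _ _ _ law _ (~` E)) lawEC; last by move=> x [].
    exact: measurableD.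
  exact: measurableC.
move=> mB; rewrite setIC -/E.
apply: (@eq_measure_le_mass _ _ _ law (mrestr m mE)) => //.
- move=> F mF; rewrite [leLHS]lawI// -[leRHS]/(m (F `&` E)).
  rewrite m_mu_star; last exact: measurableI.
  apply: (le_mu_star (mu := law)) => [D|]; last exact: measurableI.
  exact: cons_point_law_rect_le.
- by rewrite /= /mrestr setTI mass probability_setT.
- by rewrite /= /mrestr setTI mass ltry.
Qed.

End unit_rect.

Lemma floor_scale_inj (R : realType) (x y : R) :
  (forall n, Num.floor (x * n.+1%:R) = Num.floor (y * n.+1%:R)) -> x = y.
Proof.
move=> eq_floor; wlog lexy : x y eq_floor / x <= y.
  by move=> le_eq; have [/le_eq->//|/ltW/le_eq->] := leP x y.
apply/eqP; rewrite eq_le lexy /= leNgt; apply/negP => ltxy.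
have : 0 < y - x by rewrite subr_gt0.
move=> /ltr_add_invr[n]; rewrite add0r -[ltLHS]mul1r ltr_pdivrMr// mulrBl => gap.
have := ge_floor (x * n.+1%:R); have := lt_succ_floor (y * n.+1%:R).
by rewrite -eq_floor intrD => *; lra.
Qed.

Lemma lebesgue_measure_le_itv (R : realType) (A : set (measurableTypeR R))
    (x r : R) :
  measurable A -> 0 <= r -> A `<=` `[x, x + r]%classic ->
  (lebesgue_measure A <= r%:E)%E.
Proof.
move=> mA r0 Ax.
pose B : set (measurableTypeR R) := `[x, x + r]%classic.
apply: (@le_trans _ _ (lebesgue_measure B)).
  by apply: le_measure; rewrite ?inE//; exact: measurable_itv.
rewrite lebesgue_measure_itv/= lte_fin; case: ifPn => _; last first.
  by rewrite lee_fin.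
by rewrite -EFinD addrAC subrr add0r.
Qed.

Section half_cubes.
Variable R : realType.

Definition half_side (i : R) (n : nat) : set (measurableTypeR R) :=
  let k := (Num.floor (i * n.+1%:R))%:~R in `[k + 2^-1, k + 2^-1 + 1[.

Definition half_cube (i : R) : set (RN R) :=
  rect (scons `[0, 1]%classic (half_side i)).

Definition cube_side (a : nat -> int) (n : nat) : set (measurableTypeR R) :=
  `[(a n)%:~R, (a n)%:~R + 1[.

Lemma half_side_measurable i n : measurable (half_side i n).
Proof. exact: measurable_itv. Qed.

Lemma cube_side_measurable a n : measurable (cube_side a n).
Proof. exact: measurable_itv. Qed.

Lemma half_cube_measurable i : measurable (half_cube i).
Proof. by apply: rect_measurable => -[|n]; exact: measurable_itv. Qed.

Lemma half_side_measure i n : lebesgue_measure (half_side i n) = 1%E.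
Proof.
rewrite /half_side lebesgue_measure_itv/= lte_fin ltrDl ltr01.
by rewrite -EFinD addrAC subrr add0r.
Qed.

Lemma lebesgue_measure_unit_interval :
  lebesgue_measure (`[0, 1]%classic : set (measurableTypeR R)) = 1%E.
Proof. by rewrite lebesgue_measure_itv/= lte_fin ltr01 oppr0 adde0. Qed.

Lemma cubeE a : cube a = rect (cube_side a) :> set (RN R).
Proof.
by apply/seteqP; split => x /= ax n; have := ax n; rewrite /cube_side /= in_itv.
Qed.

Lemma cube_measurable a : measurable (cube a : set (RN R)).
Proof.
by rewrite cubeE; apply: rect_measurable; exact: cube_side_measurable.
Qed.

Lemma half_cubes_disjoint : trivIset setT half_cube.
Proof.
move=> i j _ _ [y [yi yj]]; apply: floor_scale_inj => n.
have := yi n.+1; have := yj n.+1; rewrite /half_side /= !in_itv/=.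
move=> /andP[j_le lt_j] /andP[i_le lt_i].
apply/eqP; rewrite eq_le -!ltzD1 -!(ltr_int R) !intrD.
by apply/andP; split; lra.
Qed.

(* The integers cut a side of a half cube in its middle. *)
Lemma half_sideI_cube_side_le i a n :
  (lebesgue_measure (half_side i n `&` cube_side a n.+1) <= (2^-1)%:E)%E.
Proof.
have mI : measurable (half_side i n `&` cube_side a n.+1).
  by apply: measurableI; exact: measurable_itv.
rewrite /half_side /cube_side in mI *; set k := Num.floor _ in mI *.
pose x : R := if (a n.+1 <= k)%R then k%:~R + 2^-1 else k%:~R + 1.
apply: (@lebesgue_measure_le_itv _ _ x) => // y []; rewrite /= !in_itv/=.
move=> /andP[k_le lt_k] /andP[a_le lt_a]; rewrite /x; case: (leP (a n.+1) k).
  by rewrite -(ler_int R) => ak; apply/andP; split; lra.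
by rewrite -lezD1 -(ler_int R) intrD => ka; apply/andP; split; lra.
Qed.

Variable m : {measure set (RN R) -> \bar R}.
Hypothesis m_mu_star : forall A : set (RN R), measurable A -> m A = mu_star A.

Lemma half_cubeI_cube_null i a : m (half_cube i `&` cube a) = 0%E.
Proof.
pose D n := half_side i n `&` cube_side a n.+1.
pose A := (`[0, 1] : set (measurableTypeR R)) `&` cube_side a 0.
have -> : half_cube i `&` cube a = rect (scons A D).
  by rewrite cubeE rectI; congr rect; apply/funext => -[].
have mD n : measurable (D n) by apply: measurableI; exact: measurable_itv.
have mA : measurable A by apply: measurableI; exact: measurable_itv.
have A1 : (lebesgue_measure A <= 1)%E.
  rewrite -lebesgue_measure_unit_interval.
  by apply: measureIl; exact: measurable_itv.
have D_half n : (lebesgue_measure (D n) <= (2^-1)%:E)%E.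
  exact: half_sideI_cube_side_le.
have D1 n : (lebesgue_measure (D n) <= 1)%E.
  by rewrite (le_trans (D_half n))// lee_fin; lra.
have fD : finite_rect D by exact: finite_rect_le1.
have fAD : finite_rect (scons A D) by apply: finite_rect_le1 => -[].
apply/eqP; rewrite eq_le measure_ge0 andbT.
apply: le_trans (measure_rect_le m_mu_star fAD) _.
rewrite vol_scons; last exact: finite_rect_cvg.
  by rewrite (vol_lt1_eq0 _ fD D_half) ?mule0//; lra.
by rewrite ge0_fin_numE// (le_lt_trans A1)// ltry.
Qed.

Definition unit_interval_prob : probability (measurableTypeR R) R :=
  @prestr _ (measurableTypeR R) R lebesgue_measure _ (measurable_itv `[0, 1])
    lebesgue_measure_unit_interval.

Definition half_cube_tail_prob i : probability (RN R) R :=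
  prestr (rect_measurable (half_side_measurable i))
    (measure_unit_rect m_mu_star (half_side_measurable i)
      (half_side_measure i)).

Lemma half_cubes_product_copies :
  product_copies m unit_interval_prob half_cube (coordinate 0)
    half_cube_tail_prob (@cons_point R).
Proof. by split=> // i A mA; exact: cons_point_law. Qed.

Lemma half_cubes_disjoint_copies :
  disjoint_copies m unit_interval_prob half_cube (coordinate 0).
Proof.
apply: product_copies_disjoint_copies half_cubes_product_copies _ _.
- exact: half_cube_measurable.
- exact: half_cubes_disjoint.
Qed.

End half_cubes.

Section ellp_lp_sum.
Variables (R : realType) (p : R).
Hypothesis p0 : 0 < p.
Local Notation nu := (unit_interval_prob R).

Lemma ellp_normE (g : R -> measurableTypeR R -> R) : ellp_norm p g =
  ((\esum_(i in setT) energy nu p setT (g i)) `^ p^-1)%E.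
Proof.
rewrite /ellp_norm; congr (_ `^ _)%E; apply: eq_esum => i _.
by rewrite poweR_Lnorm// gt_eqF.
Qed.

Lemma ellpP (g : R -> measurableTypeR R -> R) :
  ellp p g <-> lp_sum nu p g.
Proof.
have pV0 : p^-1 != 0 by rewrite invr_neq0// gt_eqF.
rewrite /ellp ellp_normE; split=> [[Lg /(lty_poweRy pV0) fin]|[mg fin]].
  by split=> // i; have /(Lfun_energyP _ p0)[] := Lg i.
split; last exact: poweR_lty.
move=> i; apply/(Lfun_energyP _ p0); split=> //; apply: le_lt_trans fin.
by apply: esum_ge; exists [set i]; [split|rewrite fsbig_set1].
Qed.

End ellp_lp_sum.

Lemma copies_embed_Bp (R : realType) (m : {measure set (RN R) -> \bar R})
    (p : R) (g : R -> measurableTypeR R -> R) :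
  (forall A : set (RN R), measurable A -> m A = mu_star A) -> 0 < p ->
  ellp p g ->
  Bp m p (copies_embed (unit_interval_prob R) (@half_cube R) (coordinate 0) p g).
Proof.
move=> m_mu_star p0 /(ellpP p0) lg.
have copiesP := half_cubes_disjoint_copies m_mu_star.
split=> [|a]; first exact: (copies_embed_Lfun copiesP p0).
apply: (energy_copies_embed_null copiesP p0 lg); first exact: cube_measurable.
by move=> i; exact: half_cubeI_cube_null.
Qed.

Theorem theorem3p6 (R : realType) (m : {measure set (RN R) -> \bar R})
    (hm : forall A : set (RN R), measurable A -> m A = mu_star A)
    (p : R) (hp : 1 <= p) :
  exists (J : (R -> measurableTypeR R -> R) -> (RN R -> R))
         (P : (RN R -> R) -> (RN R -> R)),
  ((* J maps l^p(c, L^p[0,1]) into B^p, linearly and isometrically *)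
      (forall g, ellp p g -> Bp m p (J g)) /\
      (forall g h (a : R), ellp p g -> ellp p h ->
        J (fun i x => a * g i x + h i x) = (fun y => a * J g y + J h y) %[ae m]) /\
      (forall g, ellp p g -> Lnorm m p%:E (EFin \o J g) = ellp_norm p g)) /\
      (* P is a bounded linear projection of B^p onto the image of J *)
      ((forall f, Bp m p f -> Bp m p (P f)) /\
      (forall f1 f2 (a : R), Bp m p f1 -> Bp m p f2 ->
        P (fun y => a * f1 y + f2 y) = (fun y => a * P f1 y + P f2 y) %[ae m]) /\
      (exists C : R, forall f, Bp m p f ->
        (Lnorm m p%:E (EFin \o P f) <= C%:E * Lnorm m p%:E (EFin \o f))%E) /\
      (forall g, ellp p g -> P (J g) = J g %[ae m]) /\
      (forall f, Bp m p f -> exists g, ellp p g /\ P f = J g %[ae m])).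
Proof.
have p0 : 0 < p := lt_le_trans ltr01 hp.
have copiesP := half_cubes_disjoint_copies hm.
have productP := half_cubes_product_copies hm.
pose J := copies_embed (unit_interval_prob R) (@half_cube R) (coordinate 0) p.
pose avg := copies_average (half_cube_tail_prob hm) (@cons_point R).
have avg_ellp f : Bp m p f -> ellp p (avg f).
  move=> [Lf _]; apply/(ellpP p0).
  exact: (copies_average_lp_sum productP copiesP hp).
exists J, (J \o avg); split; split.
- by move=> g; exact: copies_embed_Bp.
- split=> [g h a /(ellpP p0) lg /(ellpP p0) lh|g /(ellpP p0) lg].
    exact: (copies_embed_linear copiesP p0 a lg lh).
  by rewrite (Lnorm_copies_embed copiesP p0 lg) ellp_normE.
- by move=> f /avg_ellp; exact: copies_embed_Bp.
split=> [f1 f2 a [L1 _] [L2 _]|].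
  exact: (embed_average_linear productP copiesP hp).
split.
  exists 1 => f [Lf _]; rewrite mul1e.
  exact: (Lnorm_embed_average_le productP copiesP hp).
split=> [g /(ellpP p0)|].
  exact: (embed_average_embed productP copiesP hp).
by move=> f /avg_ellp eg; exists (avg f); split=> //; exact: ae_eq_refl.
Qed.
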